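(* Let $\mathcal{A}_0=(A_0,\mathcal{F}_0)$ and $\mathcal{A}_1=(A_1,\mathcal{F}_1)$ be algebras of the same language that are isomorphic. Then $\mathcal{A}_0$ is a Ramsey algebra if and only if $\mathcal{A}_1$ is a Ramsey algebra.
   Context: An algebra $\mathcal{A}=(A,\mathcal{F})$ consists of a set $A$ and a family $\mathcal{F}$ of finitary operations $f:A^n\to A$ on $A$. When $\mathcal{L}$ is a set of function symbols (a purely functional language), an algebra of the language $\mathcal{L}$ is an $\mathcal{L}$-structure, $\mathcal{F}$ being the family of interpretations of the symbols; isomorphism is isomorphism of $\mathcal{L}$-structures. An $n$-ary $f$ is an orderly composition of a family $\mathcal{G}$ of operations if there are a $k$-ary $g\in\mathcal{G}$ and $n_j$-ary $h_j\in\mathcal{G}$ ($1\le j\le k$) with $\sum_{j=1}^k n_j=n$ such that $f(x_1,\dots,x_n)=g(h_1(\bar x_1),\dots,h_k(\bar x_k))$, where $\bar x_1,\dots,\bar x_k$ are the consecutive blocks of $(x_1,\dots,x_n)$ of lengths $n_1,\dots,n_k$. The set $\mathrm{OT}(\mathcal{F})$ of orderly terms over $\mathcal{F}$ is the smallest collection of operations on $A$ that contains $\mathcal{F}\cup\{\mathrm{id}_A\}$ and is closed under orderly composition. For infinite sequences $\vec a,\vec b\in{}^\omega A$, $\vec a$ is a reduction of $\vec b$, written $\vec a\le_{\mathcal{F}}\vec b$, if there are orderly terms $f_j\in\mathrm{OT}(\mathcal{F})$ and finite subsequences $\vec b_j$ of $\vec b$ ($j\in\omega$) such that $\vec a(j)=f_j(\vec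 b_j)$ for every $j$ and the concatenation $\vec b_0*\vec b_1*\cdots$ is a subsequence of $\vec b$. Put $\mathrm{FR}_{\mathcal{F}}(\vec b)=\{\vec a(0):\vec a\le_{\mathcal{F}}\vec b\}$. The algebra $(A,\mathcal{F})$ is a Ramsey algebra if for every $\vec b\in{}^\omega A$ and every $X\subseteq A$ there is $\vec a\le_{\mathcal{F}}\vec b$ such that $\mathrm{FR}_{\mathcal{F}}(\vec a)$ is either contained in $X$ or disjoint from $X$. *)

(* Defs.v *)
From mathcomp Require Import all_boot.
From mathcomp Require Import classical_sets.

Set Implicit Arguments.
Unset Strict Implicit.
Unset Printing Implicit Defensive.

Local Open Scope classical_set_scope.

Definition op (A : Type) (n : nat) : Type := n.-tuple A -> A.

Definition op_family (A : Type) : Type := forall n, set (op A n).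

Definition id_op (A : Type) : op A 1 := fun x => thead x.

(* f(x) = g(h_1(x_1), ..., h_k(x_k)) whenever x is the concatenation of the
   blocks x_1, ..., x_k, the block x_j having the arity of h_j as its length. *)
Definition is_orderly_comp (A : Type) (n : nat) (f : op A n) (k : nat)
    (g : op A k) (m : 'I_k -> nat) (h : forall j, op A (m j)) : Prop :=
  \sum_(j < k) m j = n /\
  forall (x : n.-tuple A) (xs : forall j, (m j).-tuple A),
    tval x = flatten [seq tval (xs j) | j <- enum 'I_k] ->
    f x = g [tuple h j (xs j) | j < k].

Inductive orderly_term (A : Type) (F : op_family A) : op_family A :=
  | OT_base n (f : op A n) : F n f -> orderly_term F f
  | OT_id : orderly_term F (@id_op A)
  | OT_comp n (f : op A n) k (g : op A k) (m : 'I_k -> nat)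
      (h : forall j, op A (m j)) :
      orderly_term F g -> (forall j, orderly_term F (h j)) ->
      is_orderly_comp f g h -> orderly_term F f.

Definition finite_subsequence (A : Type) (s : seq A) (b : nat -> A) : Prop :=
  exists2 e : nat -> nat, {homo e : i j / i < j} &
    s = mkseq (b \o e) (size s).

(* The concatenation s_0 * s_1 * ... is given by its initial segments
   s_0 * ... * s_(p-1), since it is finite when almost all s_j are empty, which
   nullary operations allow.  The same e must serve all the segments. *)
Definition concat_subsequence (A : Type) (s : nat -> seq A) (b : nat -> A)
    : Prop :=
  exists2 e : nat -> nat, {homo e : i j / i < j} &
    forall p, let c := flatten (mkseq s p) in c = mkseq (b \o e) (size c).

Definition reduction (A : Type) (F : op_family A) (a b : nat -> A) : Prop :=
  exists (n : nat -> nat) (f : forall j, op A (n j))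
         (bs : forall j, (n j).-tuple A),
    [/\ forall j, orderly_term F (f j),
        forall j, finite_subsequence (bs j) b,
        forall j, a j = f j (bs j)
      & concat_subsequence (fun j => tval (bs j)) b].

Definition FR (A : Type) (F : op_family A) (b : nat -> A) : set A :=
  [set a 0 | a in [set a | reduction F a b]].

Definition ramsey_algebra (A : Type) (F : op_family A) : Prop :=
  forall (b : nat -> A) (X : set A),
    exists2 a, reduction F a b & FR F a `<=` X \/ FR F a `&` X = set0.

Record language : Type := Language {
  symbol : Type;
  arity : symbol -> nat
}.

Record algebra (L : language) : Type := Algebra {
  carrier :> Type;
  interp : forall s : symbol L, op carrier (arity s)
}.
Arguments interp {L} A s x : rename.

Inductive operations (L : language) (A : algebra L) : op_family A :=
  | Operation (s : symbol L) : operations (interp A s).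
Arguments operations {L} A n _.

Definition isomorphism (L : language) (A B : algebra L) (phi : A -> B) : Prop :=
  bijective phi /\
  forall (s : symbol L) (x : (arity s).-tuple A),
    phi (interp A s x) = interp B s (map_tuple phi x).

Definition isomorphic (L : language) (A B : algebra L) : Prop :=
  exists phi : A -> B, isomorphism phi.

(* Main.v *)
(* Conjugation by a bijection carries orderly terms to orderly terms, hence
   reductions to reductions; apply the Ramsey property to the pulled back
   sequence and set. *)
Require Import Defs.
From mathcomp Require Import all_boot boolp classical_sets.

Set Implicit Arguments.
Unset Strict Implicit.
Unset Printing Implicit Defensive.

Local Open Scope classical_set_scope.

(** Being Ramsey is expressed through orderly terms alone, and these are transported by conjugation
    $f \mapsto \phi f \psi$, where $\psi = \phi^{-1}$: inside a composition the factors $\psi\phi$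
    cancel ([orderly_term_conj]). So $\phi$ maps reductions to reductions ([reduction_conj]), and
    likewise $\psi$. Given $b$ and $X$ in the target, a reduction $a$ of $\psi \circ b$ that is
    homogeneous for $\phi^{-1}(X)$ yields the reduction $\phi \circ a$ of $b$, homogeneous for $X$
    ([ramsey_algebra_conj]). *)

Definition conj_op (A B : Type) (phi : A -> B) (psi : B -> A) (n : nat)
    (f : op A n) : op B n :=
  fun y => phi (f (map_tuple psi y)).

(** One direction only, for arbitrary families: it serves basic operations and orderly terms alike,
    and again with [phi] and [psi] exchanged. *)
Definition conj_sub (A B : Type) (phi : A -> B) (psi : B -> A)
    (F : op_family A) (G : op_family B) : Prop :=
  forall n (f : op A n), F n f -> G n (conj_op phi psi f).

Lemma orderly_term_conj (A B : Type) (phi : A -> B) (psi : B -> A)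
    (F : op_family A) (G : op_family B) :
  cancel phi psi -> cancel psi phi -> conj_sub phi psi F G ->
  conj_sub phi psi (orderly_term F) (orderly_term G).
Proof.
move=> phiK psiK FG n f; elim=> {n f} [n f /FG|//|n f k g m h _ IHg _ IHh].
- exact: OT_base.
- have -> : conj_op phi psi (@id_op A) = @id_op B.
    by apply: funext => y; rewrite /conj_op /id_op /thead tnth_map psiK.
  exact: OT_id.
move=> [sum_m f_comp]; apply: (OT_comp IHg IHh); split=> // y ys y_flat.
(* The pulled back blocks concatenate to the pulled back [y], since mapping commutes with
   flattening. *)
rewrite /conj_op (f_comp _ (fun j => map_tuple psi (ys j))); last first.
  by rewrite /= y_flat map_flatten -map_comp.
(* The [psi] of the conjugate of [g] meets the [phi] of each conjugate of [h j]. *)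
congr (phi (g _)); apply: eq_from_tnth => j.
by rewrite tnth_mktuple tnth_map tnth_mktuple phiK.
Qed.

Lemma finite_subsequence_map (A B : Type) (phi : A -> B) s b :
  finite_subsequence s b -> finite_subsequence (map phi s) (phi \o b).
Proof.
move=> [e e_homo s_e]; exists e => //.
by rewrite size_map {1}s_e /mkseq -map_comp.
Qed.

Lemma concat_subsequence_map (A B : Type) (phi : A -> B) (s : nat -> seq A) b :
  concat_subsequence s b ->
  concat_subsequence (fun j => map phi (s j)) (phi \o b).
Proof.
move=> [e e_homo s_e]; exists e => // p /=.
have -> : mkseq (fun j => map phi (s j)) p = map (map phi) (mkseq s p).
  by rewrite /mkseq -map_comp.
by rewrite -map_flatten size_map {1}s_e /mkseq -map_comp.
Qed.

Lemma reduction_conj (A B : Type) (phi : A -> B) (psi : B -> A)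
    (F : op_family A) (G : op_family B) (a b : nat -> A) :
  cancel phi psi -> cancel psi phi -> conj_sub phi psi F G ->
  reduction F a b -> reduction G (phi \o a) (phi \o b).
Proof.
move=> phiK psiK FG [n [f [bs [f_term bs_sub a_f bs_concat]]]].
exists n, (fun j => conj_op phi psi (f j)), (fun j => map_tuple phi (bs j)).
split=> [j|j|j|].
- exact: (orderly_term_conj phiK psiK FG).
- exact: finite_subsequence_map.
- rewrite /conj_op /= a_f; congr (phi (f j _)).
  by apply: eq_from_tnth => i; rewrite !tnth_map phiK.
- exact: (concat_subsequence_map phi bs_concat).
Qed.

Lemma ramsey_algebra_conj (A B : Type) (phi : A -> B) (psi : B -> A)
    (F : op_family A) (G : op_family B) :
  cancel phi psi -> cancel psi phi ->
  conj_sub phi psi F G -> conj_sub psi phi G F ->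
  ramsey_algebra F -> ramsey_algebra G.
Proof.
move=> phiK psiK FG GF ramseyF b X.
have [a a_red FR_a] := ramseyF (psi \o b) (phi @^-1` X).
exists (phi \o a).
  have -> : b = phi \o (psi \o b) by apply: funext => i /=; rewrite psiK.
  exact: (reduction_conj phiK psiK FG).
(* Homogeneity concerns all reductions of [phi \o a], so these must be pulled back to reductions of
   [a]; this is where [GF] enters. *)
have FR_psi y : FR G (phi \o a) y -> FR F a (psi y).
  move=> [c c_red <-]; exists (psi \o c) => //=.
  have -> : a = psi \o (phi \o a) by apply: funext => i /=; rewrite phiK.
  exact: (reduction_conj psiK phiK GF).
case: FR_a => [FR_sub|FR_disj]; [left|right].
  by move=> y /FR_psi/FR_sub /=; rewrite psiK.
apply/seteqP; split=> // y [/FR_psi FRy Xy].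
have : (FR F a `&` phi @^-1` X) (psi y) by split; rewrite //= psiK.
by rewrite FR_disj.
Qed.

(** The homomorphism law makes the conjugate of the interpretation of [s] in [A] equal to its
    interpretation in [B]. *)
Lemma conj_sub_operations (L : language) (A B : algebra L) (phi : A -> B)
    (psi : B -> A) :
  cancel psi phi ->
  (forall (s : symbol L) (x : (arity s).-tuple A),
     phi (interp A s x) = interp B s (map_tuple phi x)) ->
  conj_sub phi psi (operations A) (operations B).
Proof.
move=> psiK phi_hom n f [s].
have -> : conj_op phi psi (interp A s) = interp B s; last exact: Operation.
apply: funext => y; rewrite /conj_op phi_hom; congr (interp B s _).
by apply: eq_from_tnth => i; rewrite !tnth_map psiK.
Qed.

Theorem corollary3p2 (L : language) (A0 A1 : algebra L)
    (iso : isomorphic A0 A1) :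
  ramsey_algebra (operations A0) <-> ramsey_algebra (operations A1).
Proof.
have [phi [[psi phiK psiK] phi_hom]] := iso.
have psi_hom (s : symbol L) (y : (arity s).-tuple A1) :
    psi (interp A1 s y) = interp A0 s (map_tuple psi y).
  (* The inverse of a bijective homomorphism is a homomorphism: compare the two sides after applying
     the injective [phi]. *)
  apply: (can_inj phiK); rewrite psiK phi_hom; congr (interp A1 s _).
  by apply: eq_from_tnth => i; rewrite !tnth_map psiK.
have sub01 := conj_sub_operations psiK phi_hom.
have sub10 := conj_sub_operations phiK psi_hom.
by split; [apply: (ramsey_algebra_conj phiK psiK)
          | apply: (ramsey_algebra_conj psiK phiK)].
Qed.
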